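(* Consider the discrete-time system $x(t+1)=Ax(t)+Bu(t)$, $t\in\mathbb{Z}_+$, with $x(t)\in\mathbb{R}^n$, $u(t)\in\mathbb{R}^m$, and $N$ agents with measurements $y_i(t)=C_ix(t)\in\mathbb{R}^{p_i}$, $i\in[1,N]$, communicating over a weighted digraph $\mathcal{G}=(\mathcal{V},\mathcal{E},\mathcal{A})$ with Laplacian $\mathcal{L}$. Here $A$ is in Jordan form with real eigenvalues, and all notation ($\lambda_\ell$, $r_u$, $A^{\ell,h_\ell}$, $d^{\ell,h_\ell}$, $C_i^{\ell,h_\ell}$, $\mathbb{G}_{i,k}^\ell$, $t_i^{\ell,h_\ell}$, $\mathcal{V}_3^{\ell,h_\ell}$, $\mathcal{L}^{\ell,h_\ell}$, and the observer structure) is as described in the context. Assume: (A1) the pair $\left(A,\begin{bmatrix}C_1\\ \vdots\\ C_N\end{bmatrix}\right)$ is detectable; (A2) for every $i\in[1,N]$ and every $\ell\in[1,r_u]$, the set of vectors $\{C_i^{\ell,h_\ell}\mathbb{e}_{t_i^{\ell,h_\ell}}\}_{h_\ell\in\mathbb{G}_{i,2}^\ell}\cup\{C_i^{\ell,h_\ell}\mathbb{e}_1\}_{h_\ell\in\mathbb{G}_{i,3}^\ell}$ is linearly independent. Then there exists a distributed observer of the form described in the context (i.e., there exist matrices $L_{i,d}$, $i\in[1,N]$, and real scalars $k^{\ell,h_\ell}$ such that, for all initial conditions of system and observers and all inputs $u$, the estimation errors $e_i(t)=x(t)-\hat x_i(t)$ satisfy $\lim_{t\to+\infty}e_i(t)=\mathbb{0}$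 for every $i\in[1,N]$) if and only if for every $\ell\in[1,r_u]$ and every $h_\ell\in[1,g_\ell]$ there exists $k^{\ell,h_\ell}\in\mathbb{R}$ such that $$|1-k^{\ell,h_\ell}\mu|<\frac{1}{|\lambda_\ell|}\qquad\text{for all }\mu\in\sigma(\mathcal{L}^{\ell,h_\ell}).$$
   Context: Digraph: $\mathcal{V}=[1,N]$, $\mathcal{A}\in\mathbb{R}^{N\times N}$ nonnegative with $[\mathcal{A}]_{i,j}>0$ iff $(j,i)\in\mathcal{E}$, $[\mathcal{A}]_{i,i}=0$; $\mathcal{N}_i=\{j:(j,i)\in\mathcal{E}\}$; $\mathcal{L}=\mathcal{D}-\mathcal{A}$ with $\mathcal{D}=\mathrm{diag}\{\sum_j[\mathcal{A}]_{i,j}\}_{i}$. $\sigma(M)$ denotes the spectrum; $\mathbb{e}_k$ is the $k$-th canonical vector. Structure of $A$: $A=\mathrm{diag}\{A^\ell\}_{\ell\in[1,r]}$, where $\lambda_1,\dots,\lambda_r$ are the distinct (real) eigenvalues, ordered so that $|\lambda_\ell|\ge1$ for $\ell\in[1,r_u]$ and $|\lambda_\ell|<1$ for $\ell\in[r_u+1,r]$; $A^\ell=\mathrm{diag}\{A^{\ell,h_\ell}\}_{h_\ell\in[1,g_\ell]}$ ($g_\ell$ the geometric multiplicity), and each Jordan miniblock $A^{\ell,h_\ell}\in\mathbb{R}^{d^{\ell,h_\ell}\times d^{\ell,h_\ell}}$ has $\lambda_\ell$ on the diagonal, $1$ on the superdiagonal and zeros elsewhere. The state is partitioned accordingly as $x=\mathrm{col}\{x^{\ell,h_\ell}\}$,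 the rows of $B$ as $B^{\ell,h_\ell}$, and the columns of $C_i$ as blocks $C_i^{\ell,h_\ell}\in\mathbb{R}^{p_i\times d^{\ell,h_\ell}}$. For $i\in[1,N]$, $\ell\in[1,r_u]$: $\mathbb{G}_{i,1}^\ell=\{h_\ell: C_i^{\ell,h_\ell}=\mathbb{0}\}$, $\mathbb{G}_{i,2}^\ell=\{h_\ell: C_i^{\ell,h_\ell}\mathbb{e}_1=\mathbb{0},\ C_i^{\ell,h_\ell}\neq\mathbb{0}\}$, $\mathbb{G}_{i,3}^\ell=\{h_\ell: C_i^{\ell,h_\ell}\mathbb{e}_1\neq\mathbb{0}\}$. For $h_\ell\in\mathbb{G}_{i,2}^\ell$, $t_i^{\ell,h_\ell}\in[2,d^{\ell,h_\ell}]$ is the index of the first nonzero column of $C_i^{\ell,h_\ell}$. For $\ell\in[1,r_u]$, $h_\ell\in[1,g_\ell]$: $\mathcal{V}_3^{\ell,h_\ell}=\{i\in[1,N]: h_\ell\in\mathbb{G}_{i,3}^\ell\}$, and $\mathcal{L}^{\ell,h_\ell}$ is the matrix obtained from $\mathcal{L}$ by deleting the rows and columns indexed in $\mathcal{V}_3^{\ell,h_\ell}$ (if this matrix is empty the condition is vacuous). Observer structure. For agent $i$, let $z_{i,d}$ be the subvector of $x$ consisting of: the last $d^{\ell,h_\ell}-t_i^{\ell,h_\ell}+1$ entries of $x^{\ell,h_\ell}$ for $\ell\le r_u$, $h_\ell\in\mathbb{G}_{i,2}^\ell$; all of $x^{\ell,h_\ell}$ for $\ell\le r_u$, $h_\ell\in\mathbb{G}_{i,3}^\ell$;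 and all of $x^\ell$ for $\ell>r_u$. Let $F_{i,d}$, $G_{i,d}$, $H_{i,d}$ be the corresponding principal submatrix of $A$, rows of $B$, and columns of $C_i$ (so $z_{i,d}(t+1)=F_{i,d}z_{i,d}(t)+G_{i,d}u(t)$, $y_i=H_{i,d}z_{i,d}$). Agent $i$ runs $\hat z_{i,d}(t+1)=F_{i,d}\hat z_{i,d}(t)+G_{i,d}u(t)+L_{i,d}(y_i(t)-H_{i,d}\hat z_{i,d}(t))$ with a gain matrix $L_{i,d}$, and its estimate $\hat x_i^{\ell,h_\ell}(t)$ of $x^{\ell,h_\ell}(t)$ for $\ell\le r_u$, $h_\ell\in\mathbb{G}_{i,3}^\ell$, and of $x^\ell(t)$ for $\ell>r_u$, is the corresponding subvector of $\hat z_{i,d}(t)$. For every $\ell\le r_u$ and $h_\ell\in\mathbb{G}_{i,1}^\ell\cup\mathbb{G}_{i,2}^\ell$, agent $i$ runs $\hat x_i^{\ell,h_\ell}(t+1)=A^{\ell,h_\ell}\hat x_i^{\ell,h_\ell}(t)+B^{\ell,h_\ell}u(t)+k^{\ell,h_\ell}A^{\ell,h_\ell}\sum_{j\in\mathcal{N}_i}[\mathcal{A}]_{i,j}(\hat x_j^{\ell,h_\ell}(t)-\hat x_i^{\ell,h_\ell}(t))$, where $k^{\ell,h_\ell}\in\mathbb{R}$ is a scalar gain common to all agents, and $\hat x_j^{\ell,h_\ell}$ is agent $j$'s estimate of $x^{\ell,h_\ell}$ (from either of its two observers). The full estimate $\hat x_i(t)$ stacks all these blocks $\hat x_i^{\ell,h_\ell}(t)$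 (and $\hat x_i^\ell(t)$ for stable $\ell$) in the order of $x$. *)

(* Defs.v *)
From HB Require Import structures.
From mathcomp Require Import all_boot all_order all_algebra.
From mathcomp Require Import all_classical all_reals all_analysis.
From mathcomp Require Import complex.

Set Implicit Arguments.
Unset Strict Implicit.
Unset Printing Implicit Defensive.

Import Order.TTheory GRing.Theory Num.Theory.
Import numFieldTopology.Exports numFieldNormedType.Exports.
Local Open Scope classical_set_scope.
Local Open Scope ring_scope.

(* Jordan structure of A.                                                    *)
(*  r      : number of distinct eigenvalues, indexed by 'I_r (0-based)       *)
(*  g l    : geometric multiplicity of lam l                                 *)
(*  Blk    : Jordan miniblocks (l, h_l)                                      *)
(*  d b    : size of miniblock b                                             *)
(*  St     : state coordinates (b, k), k : 'I_(d b)  (k = 0 is paper's e_1)  *)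

Definition Blk (r : nat) (g : 'I_r -> nat) : finType := {l : 'I_r & 'I_(g l)}.

Definition St (r : nat) (g : 'I_r -> nat) (d : Blk g -> nat) : finType :=
  {b : Blk g & 'I_(d b)}.

Definition blk_ev (r : nat) (g : 'I_r -> nat) (b : Blk g) : 'I_r := tag b.

Definition Ajor (R : nzRingType) (r : nat) (g : 'I_r -> nat) (d : Blk g -> nat)
  (lam : 'I_r -> R) (x y : St d) : R :=
  if tag x == tag y then
    (if (tagged y : nat) == (tagged x : nat) then lam (blk_ev (tag x))
     else if (tagged y : nat) == (tagged x).+1 then 1 else 0)
  else 0.

Definition mx_of (R : Type) (X Y : finType) (M : X -> Y -> R)
  : 'M[R]_(#|X|, #|Y|) :=
  \matrix_(a, c) M (enum_val a) (enum_val c).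

Definition in_spectrum (R : rcfType) (n : nat) (M : 'M[R]_n) (mu : R[i]) : Prop :=
  root (char_poly (map_mx (real_complex R) M)) mu.

Definition schur_stable (R : rcfType) (n : nat) (M : 'M[R]_n) : Prop :=
  forall mu : R[i], in_spectrum M mu -> `|mu| < 1.

Definition detectable (R : rcfType) (X Y : finType)
  (A : X -> X -> R) (C : Y -> X -> R) : Prop :=
  exists L : X -> Y -> R,
    schur_stable (mx_of (fun x y => A x y - \sum_(q : Y) L x q * C q y)).

Definition laplacian (R : nzRingType) (N : nat) (Adj : 'M[R]_N) : 'M[R]_N :=
  \matrix_(i, j) ((if i == j then \sum_(k < N) Adj i k else 0) - Adj i j).

Definition principal_sub (R : Type) (N : nat) (M : 'M[R]_N) (S : {set 'I_N})
  : 'M[R]_#|S| :=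
  \matrix_(a, c) M (enum_val a) (enum_val c).

Section Structure.
Variables (R : nzRingType) (r : nat) (g : 'I_r -> nat) (d : Blk g -> nat).
Variables (N : nat) (p : 'I_N -> nat) (C : forall i : 'I_N, 'I_(p i) -> St d -> R).

Definition colnz (i : 'I_N) (b : Blk g) (k : 'I_(d b)) : bool :=
  [exists q : 'I_(p i), @C i q (Tagged (fun b => 'I_(d b)) k) != 0].

Definition inG1 (i : 'I_N) (b : Blk g) : bool := [forall k : 'I_(d b), ~~ colnz i k].
Definition inG3 (i : 'I_N) (b : Blk g) : bool :=
  [exists k : 'I_(d b), ((k : nat) == 0%N) && colnz i k].
Definition inG2 (i : 'I_N) (b : Blk g) : bool := ~~ inG1 i b && ~~ inG3 i b.

(* k is the (0-based) index of the first nonzero column of C_i^b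
   (i.e. k = t_i^b - 1 for b in G2, k = 0 for b in G3). *)
Definition is_first (i : 'I_N) (b : Blk g) (k : 'I_(d b)) : bool :=
  colnz i k && [forall k' : 'I_(d b), (k' < k)%N ==> ~~ colnz i k'].

Definition V3 (b : Blk g) : {set 'I_N} := [set i | inG3 i b].

(* Coordinates of z_{i,d}: for unstable blocks (eigenvalue index < ru),
   the coordinates (b,k) with k >= first nonzero column of C_i^b (this is
   empty for G1, the last d-t+1 entries for G2, everything for G3);
   for stable blocks, all coordinates. *)
Definition Sobs (ru : nat) (i : 'I_N) (x : St d) : bool :=
  if (blk_ev (tag x) < ru)%N then
    [exists k' : 'I_(d (tag x)), (k' <= tagged x)%N && colnz i k']
  else true.

End Structure.

Definition mkblk (r : nat) (g : 'I_r -> nat) (l : 'I_r) (h : 'I_(g l)) : Blk g :=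
  Tagged (fun l => 'I_(g l)) h.

Definition mkst (r : nat) (g : 'I_r -> nat) (d : Blk g -> nat) (b : Blk g)
  (k : 'I_(d b)) : St d :=
  Tagged (fun b => 'I_(d b)) k.

(* Assumption (A2): for every agent i and unstable eigenvalue l, the first
   nonzero columns {C_i^{l,h} e_{t_i^{l,h}}}_{h in G2} u {C_i^{l,h} e_1}_{h in G3}
   (i.e. the first nonzero column of C_i^{l,h}, for every h not in G1)
   form a linearly independent family in R^{p_i}. *)
Definition assumption_A2 (R : nzRingType) (r ru : nat) (g : 'I_r -> nat)
  (d : Blk g -> nat) (N : nat) (p : 'I_N -> nat)
  (C : forall i : 'I_N, 'I_(p i) -> St d -> R) : Prop :=
  forall (i : 'I_N) (l : 'I_r), (l < ru)%N ->
  forall (c : 'I_(g l) -> R) (kf : forall h : 'I_(g l), 'I_(d (mkblk h))),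
    (forall h, ~~ inG1 C i (mkblk h) -> is_first C i (kf h)) ->
    (forall q : 'I_(p i),
        \sum_(h : 'I_(g l) | ~~ inG1 C i (mkblk h)) c h * C i q (mkst (kf h)) = 0) ->
    forall h, ~~ inG1 C i (mkblk h) -> c h = 0.

Section Observer.
Variables (R : realType) (r ru : nat) (g : 'I_r -> nat) (d : Blk g -> nat).
Variables (lam : 'I_r -> R) (m : nat) (B : St d -> 'I_m -> R).
Variables (N : nat) (p : 'I_N -> nat) (C : forall i : 'I_N, 'I_(p i) -> St d -> R).
Variable (Adj : 'M[R]_N).

Definition by_consensus (i : 'I_N) (x : St d) : bool :=
  (blk_ev (tag x) < ru)%N && ~~ inG3 C i (tag x).

(* full estimate of agent i, from the local observer state zh_i (whose
   meaningful entries are those in Sobs) and the consensus observer state w_i *)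
Definition xhat (zh w : 'I_N -> St d -> R) (i : 'I_N) (x : St d) : R :=
  if by_consensus i x then w i x else zh i x.

(* xs: plant state, u: input, zh: local (Luenberger) observers z^_{i,d},
   w: consensus observers x^_i^{l,h} for h in G1 u G2;
   Lg i: gain L_{i,d}; kg b: scalar gain k^{l,h}. *)
Definition observer_traj (Lg : forall i : 'I_N, St d -> 'I_(p i) -> R)
  (kg : Blk g -> R) (xs : nat -> St d -> R) (u : nat -> 'I_m -> R)
  (zh w : nat -> 'I_N -> St d -> R) : Prop :=
  [/\ (forall t x, xs t.+1 x =
         \sum_(y : St d) Ajor lam x y * xs t y + \sum_(c < m) B x c * u t c),
      (forall t i x, Sobs C ru i x ->
         zh t.+1 i x =
           \sum_(y : St d | Sobs C ru i y) Ajor lam x y * zh t i y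
           + \sum_(c < m) B x c * u t c
           + \sum_(q < p i) Lg i x q *
               (\sum_(y : St d) @C i q y * xs t y
                - \sum_(y : St d | Sobs C ru i y) @C i q y * zh t i y)) &
      (forall t i x, by_consensus i x ->
         w t.+1 i x =
           \sum_(y : St d) Ajor lam x y * w t i y
           + \sum_(c < m) B x c * u t c
           + kg (tag x) * \sum_(y : St d) Ajor lam x y *
               \sum_(j < N) Adj i j * (xhat (zh t) (w t) j y - w t i y))].

(* The distributed observer (with gains Lg, kg) solves the estimation
   problem: for every input and every initial condition (i.e. every
   trajectory of the interconnection), all estimation errors tend to 0. *)
Definition observer_converges (Lg : forall i : 'I_N, St d -> 'I_(p i) -> R)
  (kg : Blk g -> R) : Prop :=
  forall xs u zh w, observer_traj Lg kg xs u zh w ->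
  forall (i : 'I_N) (x : St d),
    (fun t => xs t x - xhat (zh t) (w t) i x) @ \oo --> (0 : R).

End Observer.

(* Main.v *)
Require Import Defs.
From HB Require Import structures.
From mathcomp Require Import all_boot all_order all_algebra.
From mathcomp Require Import all_classical all_reals all_analysis.
From mathcomp Require Import complex ring.
Import Order.TTheory GRing.Theory Num.Theory.
Import numFieldTopology.Exports numFieldNormedType.Exports.
Import Normc.

Set Implicit Arguments.
Unset Strict Implicit.
Unset Printing Implicit Defensive.

Local Open Scope classical_set_scope.
Local Open Scope ring_scope.

(** The local error of agent i obeys [e(t+1) = (F - L H) e(t)]. By (A2), H is injective on the
    eigenvectors of F with an unstable eigenvalue, so these eigenvalues can be moved to 0 one at
    a time by rank-one gains. On an unstable Jordan block b, the errors of the agents outside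
    [V3 b], taken coordinate by coordinate, are governed by [lambda (I - k L^b)] and driven by
    the local errors of [V3 b] and by the next coordinate of the block; the spectral condition
    says that this matrix is Schur stable. Conversely, an eigenvector v of [L^b] for mu gives
    the error trajectory [Re ((lambda (1 - k mu))^t v)] on the first coordinate of the block,
    and it tends to 0 only if [|lambda (1 - k mu)| < 1]. *)

(** * Pole shifting *)

(** Two block factorizations involving the bordered matrix [M] are compared. The factor [a] on both
    sides avoids a division, so the identity applies to polynomial entries. *)
Lemma det_scalar_add_rank1 (K : comNzRingType) n (a : K) (v : 'cV_n) (c : 'rV_n) :
  a * \det (a%:M + v *m c) = (a + (c *m v) 0 0) * a ^+ n.
Proof.
pose M : 'M[K]_(1 + n) := block_mx 1 (- c) v a%:M.
have -> : \det (a%:M + v *m c) = \det M.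
  have -> : M = block_mx 1 0 v 1%:M *m block_mx 1 (- c) 0 (a%:M + v *m c).
    rewrite mulmx_block !(mul1mx, mul0mx, mulmx0, mulmx1, addr0).
    by rewrite mulmxN addrC addrK.
  by rewrite det_mulmx det_lblock det_ublock !det1 !mul1r.
have -> : a = \det (block_mx a%:M 0 (- v) 1%:M : 'M[K]_(1 + n)).
  by rewrite det_lblock det1 mulr1 det_scalar1.
rewrite mulrC -det_mulmx mulmx_block !(mul1mx, mul0mx, mulmx0, mulmx1, addr0, add0r).
rewrite mulNmx mulmxN opprK mul_mx_scalar mulmxN mul_scalar_mx subrr.
rewrite det_ublock det_lblock det1 mulr1 det_scalar det_scalar1 det_mx11.
by rewrite !mxE eqxx mulr1n.
Qed.

(* Multiplying [xI - F + vc] by [x - lam] factors it as [(xI - F)((x - lam)I + vc)]. *)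
Lemma char_poly_sub_eigen (K : idomainType) n (F : 'M[K]_n) (v : 'cV_n)
    (c : 'rV_n) (lam : K) : F *m v = lam *: v ->
  char_poly F * ('X - (lam - (c *m v) 0 0)%:P) =
  ('X - lam%:P) * char_poly (F - v *m c).
Proof.
move=> Fv; set a := 'X - lam%:P.
have a0 : a != 0 by rewrite polyXsubC_eq0.
pose pv := map_mx polyC v; pose pc := map_mx polyC c.
have E : char_poly_mx F *m (a%:M + pv *m pc) = a *: char_poly_mx (F - v *m c).
  rewrite /char_poly_mx map_mxB map_mxM -/pv -/pc opprB addrCA scalerDr.
  rewrite mulmxDr mul_mx_scalar [RHS]addrC; congr (_ + _).
  rewrite mulmxBl mulmxA [X in _ - X]mulmxA -map_mxM Fv map_mxZ.
  by rewrite mul_scalar_mx -!scalemxAl -scalerBl.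
have := congr1 (fun M => \det M) E; rewrite /= det_mulmx detZ => D.
have an : a ^+ n.+1 != 0 by rewrite expf_neq0.
have D1 : a * \det (a%:M + pv *m pc) = (a + ((c *m v) 0 0)%:P) * a ^+ n.
  by rewrite det_scalar_add_rank1 -map_mxM [map_mx _ _ _ _]mxE.
rewrite /char_poly polyCB opprB addrCA -/a [_ + a]addrC; apply: (mulfI an).
set x := \det (char_poly_mx F); set y := \det _; set z := a + _.
rewrite exprS -!mulrA; congr (_ * _).
rewrite [a ^+ n * (a * y)]mulrCA -D [RHS]mulrCA D1.
by rewrite mulrCA [a ^+ n * z]mulrC.
Qed.

(** A matrix and its transpose share their characteristic polynomial, which turns row eigenvectors
    into the column eigenvectors used below. *)
Lemma root_char_polyP (K : fieldType) n (M : 'M[K]_n) (a : K) :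
  reflect (exists2 v : 'cV_n, M *m v = a *: v & v != 0) (root (char_poly M) a).
Proof.
have -> : char_poly M = char_poly M^T.
  rewrite /char_poly -det_tr; congr (\det _).
  by rewrite /char_poly_mx linearB /= tr_scalar_mx map_trmx.
rewrite -eigenvalue_root_char.
apply: (iffP eigenvalueP) => -[v Mv v0]; exists v^T; rewrite ?trmx_eq0 //.
  by apply: trmx_inj; rewrite trmx_mul trmxK Mv linearZ /= trmxK.
by rewrite -trmx_mul Mv linearZ.
Qed.

(* While [F] has an eigenvector [v] with an unstable eigenvalue, [H v] is nonzero, so a gain
   [v *m l] moves that eigenvalue to [0] and keeps the other ones; vectors killed by [H] do
   not see the new gain, so the hypothesis on the eigenvectors survives. *)
Lemma stabilizing_gain (K : realFieldType) n q (F : 'M[K]_n) (H : 'M[K]_(q, n))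
    (s : seq K) :
  char_poly F = \prod_(z <- s) ('X - z%:P) ->
  (forall (mu : K) (v : 'cV_n), 1 <= `|mu| -> F *m v = mu *: v ->
     H *m v = 0 -> v = 0) ->
  exists L : 'M[K]_(n, q), exists2 s' : seq K,
    char_poly (F - L *m H) = \prod_(z <- s') ('X - z%:P)
    & all (fun z => `|z| < 1) s'.
Proof.
move: {2}(count (fun z => 1 <= `|z|) s) (erefl (count (fun z => 1 <= `|z|) s)) => k.
elim: k F s => [|k IHk] F s.
  move=> ks chF _; exists 0; exists s; first by rewrite mul0mx subr0.
  apply/allP => z zs; rewrite ltNge; apply/negP => z1.
  have : has (fun z => 1 <= `|z|) s by apply/hasP; exists z.
  by rewrite has_count ks.
move=> ks chF obs.
have /hasP[lam lams lam1] : has (fun z => 1 <= `|z|) s by rewrite has_count ks.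
have /root_char_polyP[v Fv v0] : root (char_poly F) lam.
  by rewrite chF root_prod_XsubC.
have /matrix0Pn[j [j' Hvj]] : H *m v != 0.
  by apply/eqP => Hv; move/eqP: v0; apply; apply: obs Fv Hv.
rewrite (ord1 j') in Hvj.
(* The scaling makes [l *m H *m v] equal to [lam], so the shifted eigenvalue is [lam - lam = 0]. *)
pose l : 'rV_q := (lam / (H *m v) j 0) *: delta_mx 0 j.
have lHv : (l *m H *m v) 0 0 = lam.
  rewrite -mulmxA /l; move: (H *m v) Hvj => w wj.
  by rewrite -scalemxAl -rowE !mxE divfK.
pose F' := F - v *m (l *m H).
have [|||L [s' chL s'1]] := IHk F' (0 :: rem lam s).
- rewrite /= normr0 ler10 add0n; apply/eqP.
  by rewrite -eqSS -ks (permP (perm_to_rem lams)) /= lam1.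
- have := @char_poly_sub_eigen _ _ F v (l *m H) lam Fv.
  rewrite lHv subrr chF (perm_big _ (perm_to_rem lams)) !big_cons /= -mulrA.
  have lam0 : 'X - lam%:P != 0 :> {poly K} by rewrite polyXsubC_eq0.
  by move/(mulfI lam0) => <-; rewrite mulrC.
- move=> mu w mu1 F'w Hw; apply: (obs mu w mu1 _ Hw); rewrite -F'w.
  by rewrite mulmxBl -!mulmxA Hw !mulmx0 subr0.
exists (v *m l + L); exists s' => //.
by rewrite mulmxDl opprD addrA -mulmxA.
Qed.

(** * Perturbed linear recurrences *)

Section CvgZero.
Variable R : realType.
Implicit Types u v : nat -> R.

Lemma cvg0D u v : u @ \oo --> (0 : R) -> v @ \oo --> (0 : R) ->
  (fun t => u t + v t) @ \oo --> (0 : R).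
Proof. by move=> u0 v0; rewrite -[X in _ --> X](addr0 (0 : R)); apply: cvgD. Qed.

Lemma cvg0M (c : R) u : u @ \oo --> (0 : R) ->
  (fun t => c * u t) @ \oo --> (0 : R).
Proof.
by move=> u0; rewrite -(mulr0 c); apply: cvgM => //; exact: cvg_cst.
Qed.

Lemma cvg0B u v : u @ \oo --> (0 : R) -> v @ \oo --> (0 : R) ->
  (fun t => u t - v t) @ \oo --> (0 : R).
Proof. by move=> u0 v0; rewrite -[X in _ --> X](subr0 (0 : R)); apply: cvgB. Qed.

Lemma cvg0_ext u v : u =1 v -> u @ \oo --> (0 : R) -> v @ \oo --> (0 : R).
Proof. by move=> /funext ->. Qed.

Lemma cvg0_sum (I : Type) (s : seq I) (P : pred I) (u : I -> nat -> R) :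
  (forall i, P i -> u i @ \oo --> (0 : R)) ->
  (fun t => \sum_(i <- s | P i) u i t) @ \oo --> (0 : R).
Proof.
move=> u0; elim: s => [|i s IHs].
  by apply: cvg0_ext (cvg_cst (0 : R)) => t; rewrite big_nil.
case Pi : (P i); last by apply: cvg0_ext IHs => t; rewrite big_cons Pi.
by apply: cvg0_ext (cvg0D (u0 i Pi) IHs) => t; rewrite big_cons Pi.
Qed.

End CvgZero.

Lemma squeeze_cvg0 (R : realType) (a b : nat -> R) :
  (forall t, 0 <= a t <= b t) -> b @ \oo --> (0 : R) -> a @ \oo --> (0 : R).
Proof.
move=> ab b0; apply: (squeeze_cvgr _ (cvg_cst 0) b0).
by near=> t; exact: ab.
Unshelve. all: by end_near.
Qed.

(** Once [|f|] stays below [(1 - q) e / 2], the value [e / 2] is the fixed point of the bounding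
    recursion, and [a (T + s)] exceeds it by at most [q ^ s * a T]. *)
Lemma contraction_cvg0 (R : realType) (q : R) (a f : nat -> R) :
  0 <= q < 1 -> (forall t, 0 <= a t) ->
  (forall t, a t.+1 <= q * a t + f t) -> f @ \oo --> (0 : R) ->
  a @ \oo --> (0 : R).
Proof.
move=> /andP[q0 q1] a0 af /cvgrPdist_lt f0; apply/cvgrPdist_lt => e e0.
have q1' : 0 < 1 - q by rewrite subr_gt0.
have e2 : 0 < e / 2 by rewrite divr_gt0.
have [T _ fT] := f0 _ (mulr_gt0 q1' e2).
have bd s : a (T + s)%N <= q ^+ s * a T + e / 2.
  elim: s => [|s IHs]; first by rewrite addn0 expr0 mul1r lerDl ltW.
  rewrite addnS; apply: le_trans (af _) _.
  have := fT (T + s)%N (leq_addr _ _); rewrite /= sub0r normrN => /ltW/ler_normlW fs.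
  apply: le_trans (lerD (ler_wpM2l q0 IHs) fs) _.
  by rewrite mulrDr mulrA -exprS -addrA -mulrDl [q + _]addrC subrK mul1r.
have /cvgrPdist_lt/(_ _ e2)[S _ gS] :
    geometric (a T) q @ \oo --> (0 : R) by apply: cvg_geometric; rewrite ger0_norm.
near=> t; rewrite sub0r normrN ger0_norm //.
have tTS : (T + S <= t)%N by near: t; exists (T + S)%N.
have -> : t = (T + (t - T))%N by rewrite subnKC // (leq_trans (leq_addr _ _) tTS).
apply: le_lt_trans (bd _) _; rewrite [ltRHS](splitr e) ltrD2r.
have /gS /= : (S <= t - T)%N by rewrite leq_subRL ?(leq_trans (leq_addr _ _) tTS).
by rewrite sub0r normrN mulrC; apply: le_lt_trans; rewrite ler_norm.
Unshelve. all: by end_near.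
Qed.

(** * Complex sequences measured by their modulus *)

Lemma normc_ge0 (R : rcfType) (x : R[i]) : 0 <= normc x.
Proof. by case: x => x y; rewrite sqrtr_ge0. Qed.

Lemma normcE (R : rcfType) (x : R[i]) : `|x| = (normc x)%:C%C.
Proof. by []. Qed.

Lemma normc_real (R : rcfType) (x : R) : normc (real_complex R x) = `|x|.
Proof. by rewrite /normc /= expr0n addr0 sqrtr_sqr. Qed.

Lemma normcX (R : rcfType) (x : R[i]) k : normc (x ^+ k) = normc x ^+ k.
Proof. by elim: k => [|k IHk]; rewrite ?expr0 ?normc1 // !exprS normcM IHk. Qed.

Definition vanishing (R : realType) (u : nat -> R[i]) : Prop :=
  (fun t => normc (u t)) @ \oo --> (0 : R).

Section Vanishing.
Variable R : realType.
Implicit Types (u v : nat -> R[i]).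

Lemma vanishing_ext u v : u =1 v -> vanishing u -> vanishing v.
Proof. by move=> /funext ->. Qed.

Lemma vanishing0 : vanishing (R := R) (fun=> 0).
Proof. by rewrite /vanishing normc0; apply: cvg_cst. Qed.

Lemma vanishingD u v :
  vanishing u -> vanishing v -> vanishing (fun t => u t + v t).
Proof.
move=> u0 v0.
apply: (squeeze_cvg0 (b := fun t => normc (u t) + normc (v t))) => [t|].
  by rewrite normc_ge0; exact: (le_normcD (u t) (v t)).
exact: cvg0D.
Qed.

Lemma vanishingZ (c : R[i]) u : vanishing u -> vanishing (fun t => c * u t).
Proof.
move=> u0; apply: (squeeze_cvg0 (b := fun t => normc c * normc (u t))) => [t|].
  by rewrite normc_ge0 normcM lexx.
exact: cvg0M.
Qed.

Lemma vanishing_sum (I : Type) (s : seq I) (P : pred I) (u : I -> nat -> R[i]) :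
  (forall i, P i -> vanishing (u i)) ->
  vanishing (fun t => \sum_(i <- s | P i) u i t).
Proof.
move=> u0; elim: s => [|i s IHs].
  by apply: vanishing_ext vanishing0 => t; rewrite big_nil.
case Pi : (P i); last first.
  by apply: vanishing_ext IHs => t; rewrite big_cons Pi.
by apply: vanishing_ext (vanishingD (u0 i Pi) IHs) => t; rewrite big_cons Pi.
Qed.

Lemma vanishing_contraction (z : R[i]) u : normc z < 1 ->
  vanishing (fun t => u t.+1 - z * u t) -> vanishing u.
Proof.
move=> z1 u0; apply: (contraction_cvg0 (q := normc z) _ _ _ u0) => [|t|t].
- by rewrite normc_ge0.
- exact: normc_ge0.
rewrite -normcM addrC -{1}[u t.+1](subrK (z * u t)).
exact: (le_normcD (u t.+1 - z * u t) (z * u t)).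
Qed.

(* By Cayley-Hamilton, applying [M - z] for all the roots [z] of the characteristic polynomial
   to [e] gives [0]; the factors are then peeled off one at a time, since [(M - z) y] is
   [y(t+1) - z y(t)] up to a vanishing term. *)
Lemma vanishing_linear_recurrence n (M : 'M[R[i]]_n) (e : nat -> 'cV[R[i]]_n) :
  (forall z, root (char_poly M) z -> normc z < 1) ->
  (forall i, vanishing (fun t => (e t.+1 - M *m e t) i 0)) ->
  forall i, vanishing (fun t => e t i 0).
Proof.
case: n M e => [|n] M e; first by move=> _ _ [].
move=> Mz Me.
have [s chM] := closed_field_poly_normal (char_poly M).
rewrite (monicP (char_poly_monic M)) scale1r in chM.
have {Mz} : all (fun z => normc z < 1) s.
  by apply/allP => z zs; apply: Mz; rewrite chM root_prod_XsubC.
pose P s := horner_mx M (\prod_(z <- s) ('X - z%:P)).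
have : forall i, vanishing (fun t => (P s *m e t) i 0).
  move=> i; apply: vanishing_ext vanishing0 => t.
  by rewrite /P -chM Cayley_Hamilton mul0mx mxE.
elim: s {chM} => [|z s IHs] /= => [Pe _ i|Pe /andP[z1 s1]].
  by apply: vanishing_ext (Pe i) => t; rewrite /P big_nil rmorph1 mul1mx.
apply: IHs s1 => i; apply: (vanishing_contraction z1).
have Q0 : vanishing (fun t => (P s *m (e t.+1 - M *m e t)) i 0).
  apply: (vanishing_ext (u := fun t => \sum_j P s i j * (e t.+1 - M *m e t) j 0)).
    by move=> t; rewrite [RHS]mxE.
  by apply: vanishing_sum => j _; apply: vanishingZ.
apply: vanishing_ext (vanishingD (Pe i) Q0) => t.
have subE (A B : 'cV[R[i]]_n.+1) : A i 0 - z * B i 0 = (A - z *: B) i 0.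
  by rewrite !mxE.
have addE (A B : 'cV[R[i]]_n.+1) : A i 0 + B i 0 = (A + B) i 0 by rewrite mxE.
rewrite subE addE; congr (fun_of_matrix _ i 0); rewrite /P big_cons mulrC rmorphM rmorphB /=.
rewrite horner_mx_X horner_mx_C -mulmxA mulmxBl mul_scalar_mx !mulmxBr -scalemxAr.
by rewrite addrC addrA subrK.
Qed.

Lemma cvg0_linear_recurrence n (M : 'M[R]_n) (e : nat -> 'cV[R]_n) :
  schur_stable M ->
  (forall i, (fun t => (e t.+1 - M *m e t) i 0) @ \oo --> (0 : R)) ->
  forall i, (fun t => e t i 0) @ \oo --> (0 : R).
Proof.
move=> Mst Me i; apply/norm_cvg0P.
have vanE (f : nat -> R) :
    vanishing (fun t => real_complex R (f t)) = (`|f t| @[t --> \oo] --> (0 : R)).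
  by rewrite /vanishing; under eq_fun do rewrite normc_real.
rewrite -vanE.
pose E t := map_mx (real_complex R) (e t).
apply: (vanishing_ext (u := fun t => E t i 0)) => [t|]; first by rewrite mxE.
apply: (vanishing_linear_recurrence (M := map_mx (real_complex R) M)) => [z|j].
  by move=> /Mst; rewrite normcE -[1]/(real_complex R 1) ltcR.
apply: (vanishing_ext (u := fun t => real_complex R ((e t.+1 - M *m e t) j 0))).
  by move=> t; rewrite /E -map_mxM -map_mxB [RHS]mxE.
by rewrite vanE; apply/norm_cvg0P; exact: Me.
Qed.

End Vanishing.

(** * Consensus dynamics *)

Lemma sum_laplacian (K : nzRingType) N (Adj : 'M[K]_N) (f : 'I_N -> K) i :
  \sum_j laplacian Adj i j * f j = \sum_j Adj i j * (f i - f j).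
Proof.
under eq_bigr do rewrite mxE mulrBl; rewrite sumrB (bigD1 i) //= eqxx.
rewrite [X in _ + X - _]big1 ?addr0 => [|j]; last first.
  by rewrite eq_sym => /negbTE ->; rewrite mul0r.
by rewrite mulr_suml -sumrB; apply: eq_bigr => j _; rewrite mulrBr.
Qed.

(** An eigenvalue [z] of this matrix is [la (1 - k mu)] for an eigenvalue [mu] of [P], recovered as
    [(1 - z / la) / k] when [k] is nonzero. *)
Lemma consensus_schur_stable (R : rcfType) n (P : 'M[R]_n) (la k : R) :
  1 <= `|la| ->
  (forall mu, in_spectrum P mu ->
     `|1 - real_complex R k * mu| < real_complex R (`|la|^-1)) ->
  schur_stable (la *: (1%:M - k *: P)).
Proof.
move=> la1 spec z /root_char_polyP[v].
have la0 : la != 0 by rewrite -normr_gt0 (lt_le_trans ltr01).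
have lac0 : real_complex R la != 0 by rewrite fmorph_eq0.
have ila1 : `|la|^-1 <= 1 by rewrite invf_le1 // normr_gt0.
rewrite map_mxZ map_mxB map_scalar_mx rmorph1 map_mxZ -scalemxAl mulmxBl mul1mx.
rewrite -scalemxAl; set Q := map_mx _ P => ev v0.
(* For [k = 0] the condition at any eigenvalue of [P] reads [1 < 1 / |la|], a contradiction; an
   eigenvalue exists because [v != 0] excludes the empty matrix. *)
have [k0|k0] := eqVneq k 0.
  have [mu rmu] : exists mu, root (char_poly Q) mu.
    apply/closed_rootP; rewrite size_char_poly eqSS.
    by case: n P v Q ev v0 {spec} => // P v Q _ /eqP[]; exact: flatmx0.
  have := spec mu rmu; rewrite k0 rmorph0 mul0r subr0 normr1 -[1]/(real_complex R 1) ltcR.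
  by rewrite ltNge ila1.
have kc0 : real_complex R k != 0 by rewrite fmorph_eq0.
pose mu := (1 - z / real_complex R la) / real_complex R k.
have /spec : in_spectrum P mu.
  apply/root_char_polyP; exists v => //.
  rewrite -/Q /mu mulrC -scalerA scalerBl scale1r [z / _]mulrC -scalerA -ev.
  by rewrite scalerA mulVf // scale1r subKr scalerA mulVf ?scale1r.
rewrite /mu mulrC divfK // subKr normrM normfV.
have -> : `|real_complex R la| = real_complex R `|la| by rewrite normcE normc_real.
rewrite rmorphV ?unitfE ?normr_eq0 // -ltr_pdivlMr ?invr_gt0 ?invrK ?mulVf //.
  by rewrite fmorph_eq0 normr_eq0.
by rewrite -[0]/(real_complex R 0) ltcR normr_gt0.
Qed.

Section Consensus.
Variables (R : realType) (N : nat) (Adj : 'M[R]_N) (S : {set 'I_N}) (la k : R).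
Hypothesis la1 : 1 <= `|la|.
Hypothesis spec : forall mu, in_spectrum (principal_sub (laplacian Adj) S) mu ->
  `|1 - real_complex R k * mu| < real_complex R (`|la|^-1).

(** This is [(I - k L) f] for the Laplacian [L]. *)
Definition consensus (f : 'I_N -> R) (i : 'I_N) : R :=
  f i - k * \sum_j Adj i j * (f i - f j).

(** The Laplacian terms with [j] outside [S] vanish in time and count as a perturbation; what
    remains is governed by the principal submatrix on [S]. *)
Lemma consensus_scalar_cvg0 (e : nat -> 'I_N -> R) :
  (forall i, i \notin S -> e^~ i @ \oo --> (0 : R)) ->
  (forall i, i \in S ->
     (fun t => e t.+1 i - la * consensus (e t) i) @ \oo --> (0 : R)) ->
  forall i, e^~ i @ \oo --> (0 : R).
Proof.
move=> eN eS i; have [iS|/eN//] := boolP (i \in S).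
pose E t : 'cV[R]_#|S| := \col_a e t (enum_val a).
apply: (cvg0_ext (u := fun t => E t (enum_rank_in iS i) 0)) => [t|].
  by rewrite mxE enum_rankK_in.
apply: (cvg0_linear_recurrence (consensus_schur_stable la1 spec)) => a.
pose ia := enum_val a; have iaS : ia \in S := enum_valP a.
pose rest t := \sum_(j | j \notin S) laplacian Adj ia j * e t j.
have rest0 : rest @ \oo --> (0 : R).
  by apply: cvg0_sum => j jS; apply/cvg0M/eN.
apply: cvg0_ext (cvg0B (eS ia iaS) (cvg0M (la * k) rest0)) => t.
rewrite /consensus -sum_laplacian (bigID (mem S)) /= -/(rest t).
rewrite big_enum_val -scalemxAl mulmxBl mul1mx -scalemxAl !mxE.
rewrite [X in _ = _ - la * (_ - k * X)](eq_bigr (fun c : 'I_#|S| =>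
  laplacian Adj ia (enum_val c) * e t (enum_val c))) => [|c _]; last first.
  by rewrite !mxE.
rewrite -[enum_val a]/ia; set x := \sum_(c < _) _.
clearbody x; ring.
Qed.

(* The last coordinate of the Jordan block evolves on its own; going up the block, each
   coordinate is driven by the next one, which vanishes. *)
Lemma consensus_cvg0 (D : nat) (e : nat -> 'I_N -> 'I_D -> R) :
  (forall i h, i \notin S -> (fun t => e t i h) @ \oo --> (0 : R)) ->
  (forall t i h, i \in S -> e t.+1 i h = la * consensus (e t ^~ h) i
     + \sum_(h' : 'I_D | (h' : nat) == h.+1) consensus (e t ^~ h') i) ->
  forall i h, (fun t => e t i h) @ \oo --> (0 : R).
Proof.
move=> eN eS i h; move: i.
have [m] := ubnP (D - h); elim: m => // m IHm in h *; rewrite ltnS => Dh.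
apply: (consensus_scalar_cvg0 (e := fun t => e t ^~ h)) => [i|i iS]; first exact: eN.
apply: (cvg0_ext (u := fun t =>
  \sum_(h' : 'I_D | (h' : nat) == h.+1) consensus (e t ^~ h') i)).
  by move=> t; rewrite eS // addrC addKr.
apply: cvg0_sum => h' /eqP hh'.
have e0 j : (fun t => e t j h') @ \oo --> (0 : R).
  apply: IHm; rewrite hh'; apply: leq_trans Dh.
  by rewrite subnS prednK // subn_gt0.
apply: cvg0B => //; apply/cvg0M/cvg0_sum => j _; apply/cvg0M/cvg0B => //.
Qed.

End Consensus.

(** * Local observers *)

Lemma mulmx_enum_rank (K : nzRingType) (X : finType) m n (A : 'M[K]_(m, #|X|))
    (B : 'M[K]_(#|X|, n)) a c :
  (A *m B) a c = \sum_(x : X) A a (enum_rank x) * B (enum_rank x) c.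
Proof. by rewrite mxE (reindex _ (onW_bij _ (@enum_rank_bij X))). Qed.

(** The sum over the next coordinate has at most one term and is empty at the end of a block, so the
    last row needs no separate case. *)
Lemma sum_Ajor (K : nzRingType) (r : nat) (g : 'I_r -> nat) (d : Blk g -> nat)
    (lam : 'I_r -> K) (x : St d) (f : St d -> K) :
  \sum_(y : St d) Ajor lam x y * f y =
  lam (blk_ev (tag x)) * f x
  + \sum_(k : 'I_(d (tag x)) | (k : nat) == (tagged x).+1) f (mkst k).
Proof.
case: x => b k /=.
transitivity (\sum_(c : Blk g) \sum_(j : 'I_(d c))
    Ajor lam (mkst k) (mkst j) * f (mkst j)).
  rewrite sig_big_dep /=; apply: eq_bigr => -[c j] _ //.
rewrite (bigD1 b) //= [X in _ + X]big1 ?addr0 => [|c cb]; last first.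
  by apply: big1 => j _; rewrite /Ajor /= eq_sym (negbTE cb) mul0r.
rewrite (bigD1 k) //= /Ajor /= !eqxx; congr (_ + _).
rewrite [RHS]big_mkcond [LHS]big_mkcond; apply: eq_bigr => j _.
rewrite -[j != k]/((j : nat) != k).
have [->|jk] := eqVneq (j : nat) k; first by rewrite ltn_eqF.
by case: ifP => _; rewrite ?mul1r ?mul0r.
Qed.

(** At the last nonzero coordinate of [v] in a block the superdiagonal term vanishes. The equation
    is asked on the support of [v] only, which suits matrices restricted to observed coordinates. *)
Lemma eigenvector_block (K : fieldType) (r : nat) (g : 'I_r -> nat)
    (d : Blk g -> nat) (lam : 'I_r -> K) (mu : K) (v : St d -> K) :
  (forall x, v x != 0 -> \sum_y Ajor lam x y * v y = mu * v x) ->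
  forall x, v x != 0 -> lam (blk_ev (tag x)) = mu.
Proof.
move=> ev [b k0] v0 /=.
pose P := [pred k : 'I_(d b) | v (mkst k) != 0].
have [k Pk kmax] := @arg_maxnP _ k0 P (fun k => k : nat) v0.
apply: (mulIf Pk); rewrite -ev // sum_Ajor /= big1 ?addr0 // => j /eqP /= jk.
by apply/eqP; apply: contraT => /kmax /=; rewrite jk ltnn.
Qed.

Lemma is_first_exists (K : nzRingType) (r : nat) (g : 'I_r -> nat)
    (d : Blk g -> nat) (N : nat) (p : 'I_N -> nat)
    (C : forall i : 'I_N, 'I_(p i) -> St d -> K) (i : 'I_N) (b : Blk g) :
  ~~ inG1 C i b -> exists k : 'I_(d b), is_first C i k.
Proof.
move=> /forallPn[k0]; rewrite negbK => ck0.
have [k ck kmin] := @arg_minnP _ k0 (@colnz _ _ _ _ _ _ C i b) (fun k => k : nat) ck0.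
exists k; rewrite /is_first ck; apply/forallP => j; apply/implyP => jk.
by apply/negP => /kmin; rewrite leqNgt jk.
Qed.

Lemma is_first_uniq (K : nzRingType) (r : nat) (g : 'I_r -> nat)
    (d : Blk g -> nat) (N : nat) (p : 'I_N -> nat)
    (C : forall i : 'I_N, 'I_(p i) -> St d -> K) (i : 'I_N) (b : Blk g)
    (k k' : 'I_(d b)) :
  is_first C i k -> is_first C i k' -> k = k'.
Proof.
move=> /andP[ck /forallP fk] /andP[ck' /forallP fk'].
apply: ord_inj; case: (ltngtP k k') => // [/(implyP (fk' _))|/(implyP (fk _))].
  by rewrite ck.
by rewrite ck'.
Qed.

Section LocalObserver.
Variables (R : realType) (r ru : nat) (lam : 'I_r -> R) (g : 'I_r -> nat).
Variables (d : Blk g -> nat) (N : nat) (p : 'I_N -> nat).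
Variable C : forall i : 'I_N, 'I_(p i) -> St d -> R.
Hypothesis lam_inj : injective lam.
Hypothesis lam_u : forall l : 'I_r, (l < ru)%N <-> 1 <= `|lam l|.
Hypothesis d_gt0 : forall b : Blk g, (0 < d b)%N.
Hypothesis A2 : assumption_A2 ru C.
Variable i : 'I_N.

Local Notation S := (Sobs C ru i).

Lemma C_unobserved (q : 'I_(p i)) (x : St d) : ~~ S x -> @C i q x = 0.
Proof.
case: x => b k; rewrite /Sobs /=; case: ifP => // _ /existsPn/(_ k).
rewrite leqnn /= => /existsPn/(_ q); rewrite negbK => /eqP //.
Qed.

(** The support of [v] lies at the first nonzero columns of the blocks with eigenvalue [mu]. Hence
    [C_i v] is a combination of the vectors of (A2), and its coefficients are zero. *)
Lemma observed_eigenvector (mu : R) (v : St d -> R) :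
  1 <= `|mu| -> (forall x, ~~ S x -> v x = 0) ->
  (forall x, S x -> \sum_y Ajor lam x y * v y = mu * v x) ->
  (forall q : 'I_(p i), \sum_y @C i q y * v y = 0) ->
  forall x, v x = 0.
Proof.
move=> mu1 v0 ev Cv x0; apply/eqP; apply: contraT => vx0.
have vS x : v x != 0 -> S x by move=> vx; apply: contraNT vx => /v0 ->.
have vlam : forall x, v x != 0 -> lam (blk_ev (tag x)) = mu.
  by apply: eigenvector_block => x /vS; apply: ev.
have vfirst (b : Blk g) (k : 'I_(d b)) : v (mkst k) != 0 -> is_first C i k.
  move=> vk; have lb := vlam _ vk; rewrite /= in lb.
  have bu : (blk_ev b < ru)%N by apply/lam_u; rewrite lb.
  have := vS _ vk; rewrite /Sobs /= bu => /existsP[k' /andP[k'k ck']].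
  (* If an earlier column were nonzero, coordinate [k - 1] would be observed, and its equation
     [mu v(k-1) + v(k) = mu v(k-1)] would give [v(k) = 0]. *)
  have nck (j : 'I_(d b)) : (j < k)%N -> ~~ colnz C i j.
    move=> jk; apply/negP => cj.
    have k1 : (k.-1 < d b)%N by rewrite (leq_ltn_trans (leq_pred _)).
    have k1S : S (mkst (Ordinal k1)).
      rewrite /Sobs /= bu; apply/existsP; exists j; rewrite cj andbT.
      by rewrite -ltnS (ltn_predK jk).
    have := ev _ k1S; rewrite sum_Ajor /= lb => /(canRL (addKr _)).
    rewrite addNr (big_pred1 k); first by move/eqP; rewrite (negbTE vk).
    by move=> j'; rewrite /= (ltn_predK jk).
  apply/andP; split; last by apply/forallP => j; apply/implyP; apply: nck.
  move: k'k; rewrite leq_eqVlt => /orP[/eqP/ord_inj <- //|/nck].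
  by rewrite ck'.
move: x0 vx0 => [[l h0] k0] vx0; have lmu := vlam _ vx0; rewrite /= in lmu.
have lu : (l < ru)%N by apply/lam_u; rewrite lmu.
(* The default only concerns blocks without a nonzero column, which (A2) leaves out. *)
pose kf (h : 'I_(g l)) : 'I_(d (mkblk h)) :=
  odflt (Ordinal (d_gt0 _)) [pick k | is_first C i k].
have kfP h : ~~ inG1 C i (mkblk h) -> is_first C i (kf h).
  move=> /is_first_exists[k fk]; rewrite /kf; case: pickP => //= /(_ k).
  by rewrite fk.
have fG1 (b : Blk g) (k : 'I_(d b)) : is_first C i k -> ~~ inG1 C i b.
  by case/andP=> ck _; apply/forallPn; exists k; rewrite negbK.
pose phi h := mkst (kf h); pose A := [set h : 'I_(g l) | ~~ inG1 C i (mkblk h)]%SET.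
have phi_inj : {in A &, injective phi}.
  move=> h h' _ _ /(congr1 tag) /=; exact: eq_from_Tagged.
(* Distinct indices carry distinct eigenvalues, so every block meeting the support has index [l]. *)
have vphi x : v x != 0 -> x \in (phi @: A)%SET.
  move: x => [[l' h] k] vx; have := vlam _ vx; rewrite /= -lmu => /lam_inj ll.
  move: h k vx; rewrite /= /blk_ev /= in ll; rewrite ll => h k vx.
  have fk := vfirst _ _ vx; apply/imsetP; exists h.
    by rewrite inE; exact: fG1 fk.
  by rewrite /phi (is_first_uniq (kfP h (fG1 _ _ fk)) fk).
have c0 := @A2 i l lu (fun h => v (phi h)) kf kfP.
have /imsetP[h hA x0E] := vphi _ vx0.
rewrite x0E c0 ?eqxx // in vx0; last by move: hA; rewrite inE.
move=> q; rewrite -[RHS](Cv q) (bigID (mem (phi @: A)%SET)) /=.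
rewrite big_imset //= [X in _ + X]big1 => [|y]; last first.
  by move=> /(contraNeq (vphi y)) ->; rewrite mulr0.
by rewrite addr0; apply: eq_big => [j|j _]; rewrite ?inE // mulrC.
Qed.

(** In an unstable block the observed coordinates are those from some index on, and each row of [A]
    involves only its own coordinate and the next. The observed subsystem is therefore
    autonomous. *)
Lemma Ajor_observed (x y : St d) : S x -> ~~ S y -> Ajor lam x y = 0.
Proof.
case: x y => b k [b' k']; rewrite /Ajor /Sobs /=.
have [bb|//] := eqVneq b b'; case: _ / bb k' => k'.
case: ifP => // _ /existsP[j /andP[jk cj]] /existsPn/(_ j); rewrite cj andbT.
rewrite -ltnNge => k'j; have k'k := leq_trans k'j jk.
by rewrite !ltn_eqF // ltnS ltnW.
Qed.

(** The matrix [F_{i,d}] padded with zeros to the full state space; the padding can only add the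
    eigenvalue [0]. *)
Definition observed_Ajor (x y : St d) : R := if S x && S y then Ajor lam x y else 0.

(** A nonzero complex eigenvalue has an eigenvector supported on observed coordinates, so it is some
    [lam l], hence real. A real splitting is what pole shifting needs to yield a real gain. *)
Lemma observed_char_poly_split :
  exists s : seq R, char_poly (mx_of observed_Ajor) = \prod_(z <- s) ('X - z%:P).
Proof.
pose F := map_mx (real_complex R) (mx_of observed_Ajor).
have [s chF] := closed_field_poly_normal (char_poly F).
rewrite (monicP (char_poly_monic F)) scale1r in chF.
exists (map (@complex.Re R) s); apply: (map_poly_inj (real_complex R)).
rewrite map_char_poly chF big_map map_prod_XsubC.
rewrite !big_seq; apply: eq_bigr => z zs; congr ('X - _%:P).
have /root_char_polyP[w Fw w0] : root (char_poly F) z by rewrite chF root_prod_XsubC.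
have [->//|z0] := eqVneq z 0.
pose v x := w (enum_rank x) 0.
have ev x : \sum_y real_complex R (observed_Ajor x y) * v y = z * v x.
  have := congr1 (fun u : 'cV_#|{: St d}| => u (enum_rank x) 0) Fw.
  rewrite /= mulmx_enum_rank mxE => <-; apply: eq_bigr => y _.
  by rewrite !mxE !enum_rankK.
have vS x : v x != 0 -> S x.
  move=> vx; apply: contraT => nSx; have := ev x.
  rewrite big1 => [/esym/eqP|y _]; last first.
    by rewrite /observed_Ajor (negbTE nSx) rmorph0 mul0r.
  by rewrite mulf_eq0 (negbTE z0) (negbTE vx).
have evA x : v x != 0 ->
    \sum_y Ajor (fun l => real_complex R (lam l)) x y * v y = z * v x.
  move=> vx; rewrite -ev; apply: eq_bigr => y _.
  have [->|/vS Sy] := eqVneq (v y) 0; first by rewrite !mulr0.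
  rewrite /observed_Ajor vS //= Sy /Ajor; congr (_ * _).
  by do 3?case: ifP => _ //; rewrite ?rmorph0 ?rmorph1.
have /matrix0Pn[a [j wa]] := w0; rewrite (ord1 j) in wa.
have va : v (enum_val a) != 0 by rewrite /v enum_valK.
by rewrite -(eigenvector_block evA va).
Qed.

Lemma local_gain : exists L : St d -> 'I_(p i) -> R,
  forall e : nat -> St d -> R,
  (forall t x, S x -> e t.+1 x = \sum_(y | S y) Ajor lam x y * e t y
     - \sum_q L x q * \sum_(y | S y) @C i q y * e t y) ->
  forall x, S x -> e ^~ x @ \oo --> (0 : R).
Proof.
have [s chF] := observed_char_poly_split.
pose F := mx_of observed_Ajor.
pose H : 'M[R]_(p i, #|{: St d}|) := \matrix_(q, a) @C i q (enum_val a).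
have Fr x (w : 'cV[R]_#|{: St d}|) : (F *m w) (enum_rank x) 0 =
    \sum_y observed_Ajor x y * w (enum_rank y) 0.
  by rewrite mulmx_enum_rank; apply: eq_bigr => y _; rewrite !mxE !enum_rankK.
have Hr q (w : 'cV[R]_#|{: St d}|) : (H *m w) q 0 =
    \sum_y @C i q y * w (enum_rank y) 0.
  by rewrite mulmx_enum_rank; apply: eq_bigr => y _; rewrite !mxE !enum_rankK.
have [|L [s' chL s'1]] := stabilizing_gain (H := H) chF.
  move=> mu w mu1 Fw Hw.
  have mu0 : mu != 0 by rewrite -normr_gt0 (lt_le_trans ltr01).
  pose v x := w (enum_rank x) 0.
  have ev x : \sum_y observed_Ajor x y * v y = mu * v x.
    by rewrite -Fr Fw mxE.
  have vS x : ~~ S x -> v x = 0.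
    move=> nSx; apply: (mulfI mu0); rewrite -ev mulr0 big1 // => y _.
    by rewrite /observed_Ajor (negbTE nSx) mul0r.
  have v0 : forall x, v x = 0.
    apply: (observed_eigenvector mu1 vS) => [x Sx|q]; last by rewrite -Hr Hw mxE.
    rewrite -ev; apply: eq_bigr => y _; rewrite /observed_Ajor Sx /=.
    by case: ifP => // /negbT /vS ->; rewrite !mulr0.
  by apply/colP => a; rewrite mxE -(enum_valK a); exact: v0.
exists (fun x q => L (enum_rank x) q) => e erec x Sx.
(* Outside [S] the sequence [e] is arbitrary, so it is replaced by a trajectory [E] of the padded
   system. Both agree on [S], because [F] and [H] have zero columns elsewhere. *)
pose E t := iter t (mulmx (F - L *m H)) (\col_a e 0 (enum_val a)).
have eE t y : S y -> e t y = E t (enum_rank y) 0.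
  elim: t y => [|t IHt] y Sy; first by rewrite mxE enum_rankK.
  rewrite erec // /E iterS -/(E t) mulmxBl -mulmxA mxE Fr.
  congr (_ + _).
    rewrite big_mkcond; apply: eq_bigr => z _; rewrite /observed_Ajor Sy /=.
    by case: ifP => [/IHt ->//|_]; rewrite mul0r.
  rewrite !mxE; congr (- _); apply: eq_bigr => q _; rewrite Hr; congr (_ * _).
  rewrite big_mkcond; apply: eq_bigr => z _; case: ifP => [/IHt ->//|/negbT nSz].
  by rewrite C_unobserved // mul0r.
apply: (cvg0_ext (u := fun t => E t (enum_rank x) 0)) => [t|].
  by rewrite eE.
apply: (cvg0_linear_recurrence (M := F - L *m H)) => [z|a].
  rewrite /in_spectrum -map_char_poly chL map_prod_XsubC.
  rewrite -(big_map (real_complex R) predT (fun z => 'X - z%:P)) root_prod_XsubC.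
  case/mapP => z' /(allP s'1) z'1 ->; rewrite normcE normc_real.
  by rewrite -[1]/(real_complex R 1) ltcR.
apply: cvg0_ext (cvg_cst (0 : R)) => t.
by rewrite /E iterS subrr mxE.
Qed.

End LocalObserver.

(** * Error dynamics *)

Lemma Re_realM (R : rcfType) (x : R) (z : R[i]) :
  complex.Re (real_complex R x * z) = x * complex.Re z.
Proof. by case: z => a b /=; rewrite mul0r subr0. Qed.

Section ErrorDynamics.
Variables (R : realType) (r ru : nat) (lam : 'I_r -> R) (g : 'I_r -> nat).
Variables (d : Blk g -> nat) (m : nat) (B : St d -> 'I_m -> R).
Variables (N : nat) (p : 'I_N -> nat) (C : forall i : 'I_N, 'I_(p i) -> St d -> R).
Variable Adj : 'M[R]_N.
Variables (Lg : forall i : 'I_N, St d -> 'I_(p i) -> R) (kg : Blk g -> R).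

(** * Necessity: error modes from Laplacian eigenvectors *)

Section Necessity.
Variables (b : Blk g) (mu : R[i]) (k0 : 'I_(d b)).
Hypothesis b_u : (blk_ev b < ru)%N.
Hypothesis k0E : k0 = 0%N :> nat.
Hypothesis conv : observer_converges ru lam B C Adj Lg kg.

Local Notation S := (~: V3 C b)%SET.
Local Notation rho := (real_complex R (lam (blk_ev b)) *
  (1 - real_complex R (kg b) * mu)).

(** With plant, input and local observers at zero, the consensus estimates [Re (rho^t V)] on the
    first coordinate of [b] form a trajectory, and its errors are their opposites. *)
Lemma eigenmode_cvg0 (V : 'I_N -> R[i]) :
  (forall i, i \notin S -> V i = 0) ->
  (forall i, i \in S ->
     \sum_j real_complex R (laplacian Adj i j) * V j = mu * V i) ->
  forall i, i \in S -> (fun t => complex.Re (rho ^+ t * V i)) @ \oo --> (0 : R).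
Proof.
move=> V0 LV i iS.
pose w (t : nat) (j : 'I_N) (x : St d) : R :=
  if (tag x == b) && ((tagged x : nat) == 0%N) then complex.Re (rho ^+ t * V j)
  else 0.
have xhatE t j y : xhat ru C (fun _ _ => 0) (w t) j y = w t j y.
  rewrite /xhat; case: ifP => //; rewrite /by_consensus /w => /negbT.
  case: eqP => //= yb; case: (_ == 0%N) => //; rewrite yb b_u /= negbK => jG3.
  by rewrite V0 ?mulr0 // !inE negbK.
have tr : observer_traj ru lam B C Adj Lg kg (fun _ _ => 0) (fun _ _ => 0)
    (fun _ _ _ => 0) w.
  split=> [t x|t j x _|t j x jx].
  - by rewrite !big1 ?addr0 // => y _; rewrite mulr0.
  - rewrite !big1 ?addr0 // => [q _|y _|y _]; rewrite ?mulr0 //.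
    by rewrite !big1 ?subrr ?mulr0 // => y _; rewrite mulr0.
  rewrite [X in _ + X + _]big1 => [|c _]; last by rewrite mulr0.
  rewrite addr0 mulr_sumr -big_split /=.
  pose G y := w t j y
    + kg (tag x) * \sum_(i' < N) Adj j i' * (w t i' y - w t j y).
  rewrite (eq_bigr (fun y => Ajor lam x y * G y)) => [|y _]; last first.
    rewrite mulrDr mulrCA; congr (_ + _ * (_ * _)).
    by apply: eq_bigr => i' _; rewrite xhatE.
  have Goff (y : St d) : ~~ ((tag y == b) && ((tagged y : nat) == 0%N)) -> G y = 0.
    move=> /negbTE yb; rewrite /G /w yb add0r big1 ?mulr0 // => i' _.
    by rewrite subrr mulr0.
  (* A next coordinate never has index [0], so the mode stays on the first coordinate. *)
  rewrite sum_Ajor [X in _ + X]big1 ?addr0 => [|h /eqP hx]; last first.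
    by apply: Goff; rewrite /= hx andbF.
  have [xb|xb] := boolP ((tag x == b) && ((tagged x : nat) == 0%N)); last first.
    by rewrite Goff // mulr0 /w (negbTE xb).
  have /andP[/eqP tb _] := xb.
  have jS : j \in S by move: jx; rewrite /by_consensus tb b_u /= !inE.
  rewrite /G /w xb tb exprSr.
  transitivity (complex.Re (real_complex R (lam (blk_ev b)) *
    (rho ^+ t * V j - real_complex R (kg b) *
       \sum_i' real_complex R (laplacian Adj j i') * (rho ^+ t * V i')))).
    under eq_bigr do rewrite mulrCA; rewrite -mulr_sumr LV //.
    congr (complex.Re _); move: (rho ^+ t) (V j) (real_complex R _) (real_complex R _).
    by move=> X Y Z T; ring.
  have ReB (x1 x2 : R[i]) : complex.Re (x1 - x2) = complex.Re x1 - complex.Re x2.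
    exact: raddfB.
  have ReS (f : 'I_N -> R[i]) : complex.Re (\sum_j f j) = \sum_j complex.Re (f j).
    exact: raddf_sum.
  rewrite Re_realM ReB Re_realM ReS; congr (_ * _).
  under [in LHS]eq_bigr do rewrite Re_realM.
  rewrite (sum_laplacian Adj (fun i' => complex.Re (rho ^+ t * V i'))).
  congr (_ + _); rewrite -mulrN -sumrN; congr (_ * _).
  by apply: eq_bigr => i' _; rewrite -mulrN opprB.
have := conv tr i (mkst k0).
have E t : 0 - xhat ru C (fun _ _ => 0) (w t) i (mkst k0) =
    - complex.Re (rho ^+ t * V i) by rewrite xhatE /w /= k0E !eqxx sub0r.
under eq_fun do rewrite E; move=> /(cvg0M (-1)); apply: cvg0_ext => t.
by rewrite mulN1r opprK.
Qed.

(** The real and imaginary parts of the mode both tend to [0], so [|rho|^t |V i0|] does too, which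
    forces [|rho| < 1]. *)
Lemma observer_spectrum :
  1 <= `|lam (blk_ev b)| ->
  in_spectrum (principal_sub (laplacian Adj) S) mu ->
  `|1 - real_complex R (kg b) * mu| < real_complex R (`|lam (blk_ev b)|^-1).
Proof.
move=> lam1 /root_char_polyP[v Pv /matrix0Pn[a0 [j v0]]].
rewrite (ord1 j) in v0; pose i0 := enum_val a0.
have i0S : i0 \in S := enum_valP a0.
(* The eigenvector is extended by zero to the agents of [V3 C b], whose estimates come from local
   observers. *)
pose V i : R[i] := if i \in S then v (enum_rank_in i0S i) 0 else 0.
have Va c : V (enum_val c) = v c 0 by rewrite /V enum_valP enum_valK_in.
have V0 i : i \notin S -> V i = 0 by rewrite /V => /negbTE ->.
have LV i : i \in S ->
    \sum_j real_complex R (laplacian Adj i j) * V j = mu * V i.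
  move=> iS; rewrite (bigID (mem S)) /= [X in _ + X]big1 ?addr0; last first.
    by move=> j' /V0 ->; rewrite mulr0.
  have := congr1 (fun u : 'cV[R[i]]_#|S| => u (enum_rank_in i0S i) 0) Pv.
  rewrite /= [RHS]mxE {2}/V iS => <-; rewrite mxE big_enum_val.
  by apply: eq_bigr => c _; rewrite Va !mxE enum_rankK_in.
have reV := eigenmode_cvg0 V0 LV i0S.
(* [Im z = Re (-i z)], and [-i V] satisfies the same eigenvector equations as [V]. *)
have imV : (fun t => complex.Im (rho ^+ t * V i0)) @ \oo --> (0 : R).
  have := @eigenmode_cvg0 (fun i => - 'i%C * V i) _ _ i0 i0S.
  rewrite /=; move=> H; apply: cvg0_ext (H _ _) => [t|i /V0 ->|i /LV LVi].
  - by rewrite mulrCA; case: (rho ^+ t * V i0) => x y /=;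
      rewrite oppr0 mul0r sub0r mulN1r opprK.
  - by rewrite mulr0.
  - by rewrite [RHS]mulrCA -LVi mulr_sumr; apply: eq_bigr => i' _; rewrite mulrCA.
have nV : (fun t => normc (rho ^+ t * V i0)) @ \oo --> (0 : R).
  apply: (squeeze_cvg0 (b := fun t => `|complex.Re (rho ^+ t * V i0)|
                                   + `|complex.Im (rho ^+ t * V i0)|)).
    move=> t; rewrite normc_ge0 /=; case: (rho ^+ t * V i0) => x y /=.
    rewrite -(ler_pXn2r (n := 2)) ?nnegrE ?sqrtr_ge0 ?addr_ge0 //.
    rewrite sqr_sqrtr ?addr_ge0 ?sqr_ge0 // sqrrD !real_normK ?num_real //.
    by rewrite lerD2r lerDl mulrn_wge0 // mulr_ge0.
  by apply: cvg0D; apply/norm_cvg0P.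
have V0n : 0 < normc (V i0).
  rewrite lt_neqAle normc_ge0 andbT eq_sym; apply/eqP => /eq0_normc.
  by rewrite Va => /eqP; rewrite (negbTE v0).
have rho1 : normc rho < 1.
  rewrite ltNge; apply/negP => rho1.
  have /cvgrPdist_lt/(_ _ V0n)[T _ /(_ T (leqnn T))] := nV.
  rewrite /= sub0r normrN ger0_norm ?normc_ge0 // normcM normcX.
  by rewrite ltNge ler_peMl ?normc_ge0 // exprn_ege1.
rewrite normcE ltcR -[ltRHS]mul1r ltr_pdivlMr ?(lt_le_trans ltr01) // mulrC.
by move: rho1; rewrite normcM normc_real.
Qed.

End Necessity.

(** * Sufficiency: recurrences satisfied by the errors *)

Section Sufficiency.
Variables (xs : nat -> St d -> R) (u : nat -> 'I_m -> R).
Variables (zh w : nat -> 'I_N -> St d -> R).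
Hypothesis traj : observer_traj ru lam B C Adj Lg kg xs u zh w.

(** Neither the output nor the observed rows of [A] involve unobserved coordinates of the plant, and
    the inputs cancel. *)
Lemma local_error_rec i t x : Sobs C ru i x ->
  xs t.+1 x - zh t.+1 i x =
  \sum_(y | Sobs C ru i y) Ajor lam x y * (xs t y - zh t i y)
  - \sum_q @Lg i x q * \sum_(y | Sobs C ru i y) @C i q y * (xs t y - zh t i y).
Proof.
have sumS (f z : St d -> R) : (forall y, ~~ Sobs C ru i y -> f y = 0) ->
    \sum_y f y * z y = \sum_(y | Sobs C ru i y) f y * z y.
  move=> f0; rewrite [RHS]big_mkcond; apply: eq_bigr => y _.
  by case: ifP => // /negbT/f0 ->; rewrite mul0r.
move=> Sx; have [xsE zhE _] := traj; rewrite xsE zhE //.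
rewrite sumS => [|y]; last exact: Ajor_observed.
rewrite [X in _ - (_ + X)](eq_bigr (fun q => @Lg i x q *
  (\sum_(y | Sobs C ru i y) @C i q y * xs t y
   - \sum_(y | Sobs C ru i y) @C i q y * zh t i y))) => [|q _]; last first.
  by rewrite sumS // => y; exact: C_unobserved.
under [in RHS]eq_bigr do rewrite mulrBr.
rewrite sumrB opprD addrA; congr (_ - _); first by rewrite opprD addrACA subrr addr0.
apply: eq_bigr => q _; congr (_ * _).
by rewrite -sumrB; apply: eq_bigr => y _; rewrite mulrBr.
Qed.

Lemma consensus_error_rec i t (b : Blk g) (h : 'I_(d b)) :
  let err t i h := xs t (mkst h) - xhat ru C (zh t) (w t) i (mkst h) in
  by_consensus ru C i (mkst h) ->
  err t.+1 i h = lam (blk_ev b) * consensus Adj (kg b) (err t ^~ h) i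
   + \sum_(h' : 'I_(d b) | (h' : nat) == h.+1)
       consensus Adj (kg b) (err t ^~ h') i.
Proof.
move=> err ih; have [xsE _ wE] := traj.
have ih' (h' : 'I_(d b)) : by_consensus ru C i (mkst h') by [].
(* [c] is the error after the consensus correction: [xs] cancels in the differences of errors, so
   the next error is [A] applied to [c]. *)
pose c y := (xs t y - w t i y) - kg b * \sum_j Adj i j *
  ((xs t y - w t i y) - (xs t y - xhat ru C (zh t) (w t) j y)).
have cE (h' : 'I_(d b)) : consensus Adj (kg b) (err t ^~ h') i = c (mkst h').
  by rewrite /consensus /err /c {1 2}/xhat ih'.
rewrite cE; under eq_bigr do rewrite cE.
rewrite -(sum_Ajor lam (mkst h) c) {1}/err /xhat ih -/(xhat _ _ _ _) xsE wE //=.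
set X := \sum_(y : St d) _; set U := \sum_(e < m) _; set Y := \sum_(y : St d) _.
set Z := \sum_(y : St d) _.
transitivity (X - Y - kg b * Z); first by ring.
rewrite mulr_sumr -!sumrB; apply: eq_bigr => y _.
rewrite /c mulrBr mulrBr mulrCA; congr (_ - _ * (_ * _)).
by apply: eq_bigr => j _; congr (_ * _); ring.
Qed.

End Sufficiency.

End ErrorDynamics.

Theorem theorem1
  (R : realType)
  (* Jordan structure of A *)
  (r ru : nat) (lam : 'I_r -> R) (g : 'I_r -> nat) (d : Blk g -> nat)
  (* input matrix *)
  (m : nat) (B : St d -> 'I_m -> R)
  (* agents and their output matrices C_i *)
  (N : nat) (p : 'I_N -> nat) (C : forall i : 'I_N, 'I_(p i) -> St d -> R)
  (* weighted digraph *)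
  (Adj : 'M[R]_N)
  (Hru : (ru <= r)%N)
  (Hlam_inj : injective lam)
  (Hlam_u : forall l : 'I_r, (l < ru)%N <-> 1 <= `|lam l|)
  (Hg : forall l : 'I_r, (0 < g l)%N)
  (Hd : forall b : Blk g, (0 < d b)%N)
  (HAdj_nonneg : forall i j : 'I_N, 0 <= Adj i j)
  (HAdj_diag : forall i : 'I_N, Adj i i = 0)
  (* (A1) *)
  (HA1 : detectable (Ajor lam)
           (fun (s : {i : 'I_N & 'I_(p i)}) (x : St d) => C (tag s) (tagged s) x))
  (* (A2) *)
  (HA2 : assumption_A2 ru C) :
  (exists (Lg : forall i : 'I_N, St d -> 'I_(p i) -> R) (kg : Blk g -> R),
      observer_converges ru lam B C Adj Lg kg)
  <->
  (forall (l : 'I_r), (l < ru)%N -> forall h : 'I_(g l),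
     exists k : R, forall mu : R[i],
       in_spectrum (principal_sub (laplacian Adj) (~: V3 C (mkblk h))) mu ->
       `|1 - real_complex R k * mu| < real_complex R (`|lam l|^-1)).
Proof.
split=> [[Lg [kg conv]] l lu h | spec].
  (* The scalar gain of the convergent observer is itself the witness. *)
  exists (kg (mkblk h)) => mu.
  by apply: (observer_spectrum (k0 := Ordinal (Hd (mkblk h))) _ _ conv) => //;
    apply/Hlam_u.
(* The guard on [b] makes the statement hold for all blocks, so that choice applies; stable blocks
   receive the gain [0]. *)
have kgE (b : Blk g) : exists k : R, (blk_ev b < ru)%N -> forall mu : R[i],
    in_spectrum (principal_sub (laplacian Adj) (~: V3 C b)) mu ->
    `|1 - real_complex R k * mu| < real_complex R (`|lam (blk_ev b)|^-1).
  case: b => l h; have [lu|lu] := boolP (l < ru)%N; last by exists 0.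
  by have [k kP] := spec l lu h; exists k.
have [kg kgP] := choice kgE.
pose gain i := cid (local_gain Hlam_inj Hlam_u Hd HA2 i).
pose Lg i := sval (gain i).
exists Lg, kg => xs u zh w traj i x.
have loc j y : Sobs C ru j y ->
    ((fun t => xs t y - zh t j y) @ \oo --> (0 : R))%classic.
  move: y; apply: (svalP (gain j) (fun t y => xs t y - zh t j y)) => t y Sy.
  exact: local_error_rec traj _ _ _ Sy.
(* Such a coordinate is stable or lies in a block whose column [0] is nonzero; in both cases it is
   observed locally. *)
have nloc j y : ~~ by_consensus ru C j y ->
    ((fun t => xs t y - xhat ru C (zh t) (w t) j y) @ \oo --> (0 : R))%classic.
  move=> jy; under eq_fun do rewrite /xhat (negbTE jy).
  apply: loc; move: jy; rewrite /by_consensus /Sobs; case: ifP => //= _.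
  rewrite negbK => /existsP[k /andP[/eqP k0 ck]].
  by apply/existsP; exists k; rewrite k0 ck.
have [ix|/nloc//] := boolP (by_consensus ru C i x).
case: x ix => b h /andP[/= bu iG3].
pose err t j (h' : 'I_(d b)) := xs t (mkst h') - xhat ru C (zh t) (w t) j (mkst h').
apply: (consensus_cvg0 _ (kgP b bu) (e := err)) => [|j h'|t j h'].
- exact/Hlam_u.
- by rewrite !inE negbK => jG3; apply: nloc; rewrite /by_consensus /= jG3 andbF.
- rewrite !inE => jG3; apply: (consensus_error_rec traj).
  by rewrite /by_consensus /= bu.
Qed.
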